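(* Let $\mu$ be a measure on the unit ball $\mathbb{B}^n\subset\mathbb{R}^n$ which satisfies Lusin's condition (N), and let $D$ be a $\mu$-measurable subset of $\mathbb{B}^n$ such that $0<\mu(D)<+\infty$. (1) There is a unique point $b=b(D)\in\mathbb{B}^n$ such that $$\int_D h_b(x)\,d\mu(x)=0,$$ where $$h_b(x)=\frac{b|x-b|^2+(1-|b|^2)(b-x)}{|x-b|^2+(1-|b|^2)(1-|x|^2)}.$$ (2) The point $b(D)$ is the unique minimum of the function $$G(x)=-\int_D\log\frac{(1-|x|^2)(1-|y|^2)}{|x-y|^2+(1-|y|^2)(1-|x|^2)}\,d\mu(y),\qquad x\in\mathbb{B}^n.$$
   Context: $\mathbb{B}^n=\{x\in\mathbb{R}^n:|x|<1\}$ is the open unit ball, with Euclidean norm $|\cdot|$. Measures are defined on the Borel $\sigma$-algebra of $\mathbb{B}^n$. Lusin's condition (N): for every Borel set $E\subseteq\mathbb{B}^n$, if $\mu(E)=0$ then $\mu(g(E))=0$ for every Möbius transformation $g$ of $\mathbb{B}^n$ onto itself. Möbius transformations of $\mathbb{B}^n$ onto itself are the maps $T\circ h_a$ with $T$ an orthogonal transformation of $\mathbb{R}^n$, $a\in\mathbb{B}^n$, and $h_a$ given by the formula for $h_b$ in the statement with $b$ replaced by $a$.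
   Formalization: In (2), G may be +∞; that b(D) minimizes G is asserted always, but uniqueness of the minimum only when G is finite at some point, since otherwise G is identically +∞ and every point is a minimum. *)

(* Defs.v *)
From HB Require Import structures.
From mathcomp Require Import all_boot all_order all_algebra.
From mathcomp Require Import all_classical all_reals all_analysis.

Set Implicit Arguments.
Unset Strict Implicit.
Unset Printing Implicit Defensive.

Import Order.TTheory GRing.Theory Num.Theory.
Import numFieldNormedType.Exports.

Local Open Scope classical_set_scope.
Local Open Scope ring_scope.

(* The library norm on row vectors is the sup norm, hence a separate
   Euclidean norm. *)
Definition enorm {R : realType} {n : nat} (x : 'rV[R]_n) : R :=
  Num.sqrt (\sum_(i < n) x 0 i ^+ 2).

Lemma enorm0_lt1 (R : realType) (n : nat) : enorm (0 : 'rV[R]_n) < 1.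
Proof.
rewrite /enorm big1 ?sqrtr0 ?ltr01// => i _.
by rewrite mxE expr0n.
Qed.

Definition unit_ball (R : realType) (n : nat) : Type :=
  {x : 'rV[R]_n | enorm x < 1}.

HB.instance Definition _ (R : realType) (n : nat) :=
  SubChoice.copy (unit_ball R n) {x : 'rV[R]_n | enorm x < 1}.

HB.instance Definition _ (R : realType) (n : nat) :=
  isPointed.Build (unit_ball R n) (exist _ 0 (enorm0_lt1 R n)).

HB.instance Definition _ (R : realType) (n : nat) :=
  Topological.copy (unit_ball R n)
    (initial_topology (fun x : unit_ball R n => \val x)).

Notation borel_ball R n := (g_sigma_algebraType (@open (unit_ball R n))).

Definition hmap {R : realType} {n : nat} (b x : unit_ball R n) : 'rV[R]_n :=
  let b := \val b in let x := \val x in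
  (enorm (x - b) ^+ 2 + (1 - enorm b ^+ 2) * (1 - enorm x ^+ 2))^-1 *:
    (enorm (x - b) ^+ 2 *: b + (1 - enorm b ^+ 2) *: (b - x)).

(* Vectors are rows, so an orthogonal transformation acts by [_ *m O]. *)
Definition mobius {R : realType} {n : nat}
    (g : unit_ball R n -> unit_ball R n) : Prop :=
  exists (O : 'M[R]_n) (a : unit_ball R n),
    O *m O^T = 1%:M /\ forall x, \val (g x) = hmap a x *m O.

Definition lusin_N {R : realType} {n : nat}
    (mu : {measure set (borel_ball R n) -> \bar R}) : Prop :=
  forall E : set (borel_ball R n), measurable E -> mu E = 0%E ->
  forall g : unit_ball R n -> unit_ball R n, mobius g -> mu (g @` E) = 0%E.

(* Meant for integrands bounded on a set of finite measure: the coordinates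
   are real-valued integrals, with value 0 where the integral diverges. *)
Definition vintegral {d} {T : measurableType d} {R : realType} {n : nat}
    (mu : {measure set T -> \bar R}) (D : set T) (f : T -> 'rV[R]_n) : 'rV[R]_n :=
  \row_(i < n) (\int[mu]_(x in D) (f x 0 i)).

Definition log_kernel {R : realType} {n : nat} (x y : unit_ball R n) : R :=
  let x := \val x in let y := \val y in
  ln ((1 - enorm x ^+ 2) * (1 - enorm y ^+ 2) /
      (enorm (x - y) ^+ 2 + (1 - enorm y ^+ 2) * (1 - enorm x ^+ 2))).

(* [mu]-measurable sets are the Caratheodory measurable sets of the outer
   measure of [mu]; when of finite measure, they are the sets that differ from
   a Borel set by a subset of a Borel null set.  Their measure, and integrals
   over them, are taken with respect to the completion of [mu], which agrees
   with [mu] on Borel sets. *)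
Definition mu_measurable {R : realType} {n : nat}
    (mu : {measure set (borel_ball R n) -> \bar R})
    (D : set (unit_ball R n)) : Prop :=
  (mu^*)%mu.-cara.-measurable D.

Definition completed {R : realType} {n : nat}
    (mu : {measure set (borel_ball R n) -> \bar R}) :
    set (caratheodory_type (mu^*)%mu) -> \bar R :=
  @completed_measure_extension _ _ _ mu.
Arguments completed {R n} mu _.

HB.instance Definition _ (R : realType) (n : nat)
    (mu : {measure set (borel_ball R n) -> \bar R}) :=
  Measure.on (completed mu).

(* The kernel is nonpositive and possibly not integrable, so [Gfun] takes its
   values in [0, +oo]. *)
Definition Gfun {R : realType} {n : nat}
    (mu : {measure set (borel_ball R n) -> \bar R})
    (D : set (unit_ball R n)) (x : unit_ball R n) : \bar R :=
  (- \int[completed mu]_(y in D) (log_kernel x y)%:E)%E.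

Definition minimizer {T : Type} {R : realType} (G : T -> \bar R) (b : T)
    : Prop :=
  forall x, (G b <= G x)%E.

(* Main.v *)
Require Import Defs.
From HB Require Import structures.
From mathcomp Require Import all_boot all_order all_algebra.
From mathcomp Require Import all_classical all_reals all_analysis.
From mathcomp Require Import measurable_realfun ring lra.

Set Implicit Arguments.
Unset Strict Implicit.
Unset Printing Implicit Defensive.

Import Order.TTheory GRing.Theory Num.Theory.
Import numFieldNormedType.Exports.

Local Open Scope classical_set_scope.
Local Open Scope ring_scope.

(* Put rho(x,y) = 1 - 2 x.y + |x|^2 |y|^2 and
   U(x,y) = log (rho(x,y) / (1 - |x|^2)).  Then G(x) is the integral over D of
   U(x,y) - log (1 - |y|^2).  Unlike this integrand, U(x,.) is bounded, so
   E(x) = int_D U(x,y) is always finite, and G(x) - G(x') = E(x) - E(x') as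
   soon as G is finite somewhere.  The involution h_b moves b to the origin:
   U(x,y) - U(b,y) = U(w,z) with w = h_b(x), z = h_b(y), and two bounds on
   U(w,z) suffice, with r = |w| and q = z.w/r.
   - rho(w,z) >= (1 - rq)^2 and the strict concavity of log on [1 - r, 1 + r]
     give U(w,z) > - q log ((1 + r)/(1 - r)) for w <> 0.  Integrating, a zero b
     of int_D h_b is the strict minimum of E, hence is unique.
   - log v <= v - 1 gives U(w,z) <= 2 (|w|^2 - w.z)/(1 - |w|^2).  Integrating
     with w a small multiple of int_D h_b, a minimum b of E satisfies
     int_D h_b = 0.
   A minimum of E exists since E is locally Lipschitz and tends to infinity at
   the sphere, because more than half of the mass of D lies in some ball
   |y| <= s < 1. *)

(** * Euclidean inner product and the polynomial [rho] *)

Section dot_product.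
Context {R : realType} {n : nat}.
Implicit Types (x y z : 'rV[R]_n) (a : R).

Definition dot x y : R := \sum_(i < n) x 0 i * y 0 i.

Lemma dotC x y : dot x y = dot y x.
Proof. by apply: eq_bigr => i _; rewrite mulrC. Qed.

Lemma dotDl x y z : dot (x + y) z = dot x z + dot y z.
Proof. by rewrite -big_split; apply: eq_bigr => i _; rewrite mxE mulrDl. Qed.

Lemma dotZl a x y : dot (a *: x) y = a * dot x y.
Proof. by rewrite mulr_sumr; apply: eq_bigr => i _; rewrite mxE mulrA. Qed.

Lemma dotNl x y : dot (- x) y = - dot x y.
Proof. by rewrite -scaleN1r dotZl mulN1r. Qed.

Lemma dotDr x y z : dot x (y + z) = dot x y + dot x z.
Proof. by rewrite dotC dotDl dotC (dotC z). Qed.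

Lemma dotZr a x y : dot x (a *: y) = a * dot x y.
Proof. by rewrite dotC dotZl dotC. Qed.

Lemma dotNr x y : dot x (- y) = - dot x y.
Proof. by rewrite dotC dotNl dotC. Qed.

Definition dotE := (dotDl, dotDr, dotNl, dotNr, dotZl, dotZr).

Lemma dot0l x : dot 0 x = 0.
Proof. by rewrite -(scale0r x) dotZl mul0r. Qed.

Lemma dot_ge0 x : 0 <= dot x x.
Proof. by apply: sumr_ge0 => i _; rewrite -expr2 sqr_ge0. Qed.

Lemma dot_eq0 x : (dot x x == 0) = (x == 0).
Proof.
apply/eqP/eqP => [x0|->]; last by rewrite dot0l.
apply/rowP => i; rewrite mxE; apply/eqP; rewrite -[_ == _]orbb -mulf_eq0.
by apply/eqP/(psumr_eq0P _ x0) => // j _; rewrite -expr2 sqr_ge0.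
Qed.

Lemma enormE x : enorm x ^+ 2 = dot x x.
Proof.
rewrite /enorm sqr_sqrtr; last by apply: sumr_ge0 => i _; rewrite sqr_ge0.
by apply: eq_bigr => i _; rewrite expr2.
Qed.

Lemma enorm0 : enorm (0 : 'rV[R]_n) = 0.
Proof. by apply/eqP; rewrite -sqrf_eq0 enormE dot0l. Qed.

Lemma enorm_lt1 x : (enorm x < 1) = (dot x x < 1).
Proof. by rewrite -enormE expr_lt1// sqrtr_ge0. Qed.

Lemma cauchy_schwarz x y : dot x y ^+ 2 <= dot x x * dot y y.
Proof.
have [->|y0] := eqVneq y 0; first by rewrite dotC !dot0l mulr0 expr0n.
have y_gt0 : 0 < dot y y by rewrite lt0r dot_eq0 y0 dot_ge0.
(* This vector is |y|^2 times the component of x orthogonal to y. *)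
have := dot_ge0 (dot y y *: x - dot x y *: y).
rewrite !dotE (dotC y x) => h.
rewrite -subr_ge0 -(pmulr_rge0 _ y_gt0); lra.
Qed.

Lemma enorm_ge0 x : 0 <= enorm x.
Proof. exact: sqrtr_ge0. Qed.

Lemma cauchy_schwarz_norm x y : `|dot x y| <= enorm x * enorm y.
Proof.
rewrite -(@ler_pXn2r _ 2) ?nnegrE ?mulr_ge0 ?enorm_ge0//.
by rewrite real_normK ?num_real// exprMn !enormE cauchy_schwarz.
Qed.

(** For y <> 0 this is |y|^2 |x - y*|^2, where y* = y/|y|^2 is the inverse point of y in the unit
    sphere; the polynomial form also covers y = 0. *)
Definition rho x y : R := 1 - dot x y *+ 2 + dot x x * dot y y.

Lemma rhoE x y :
  enorm (x - y) ^+ 2 + (1 - enorm x ^+ 2) * (1 - enorm y ^+ 2) = rho x y.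
Proof. by rewrite !enormE !dotE (dotC y x) /rho; ring. Qed.

Lemma rho_ge x y : (1 - enorm x * enorm y) ^+ 2 <= rho x y.
Proof.
have := cauchy_schwarz_norm x y; rewrite ler_norml => /andP[_ xy].
rewrite /rho -!enormE; nra.
Qed.

Lemma rho_le x y : rho x y <= (1 + enorm x * enorm y) ^+ 2.
Proof.
have := cauchy_schwarz_norm x y; rewrite ler_norml => /andP[yx _].
rewrite /rho -!enormE; nra.
Qed.

Lemma rho_gt0 x y : dot x x < 1 -> dot y y < 1 -> 0 < rho x y.
Proof.
rewrite -!enorm_lt1 => x1 y1; apply: lt_le_trans (rho_ge x y).
by rewrite exprn_gt0// subr_gt0 mulr_ilt1 ?enorm_ge0.
Qed.

End dot_product.

(** * The involution h_b on row vectors *)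

Section hyperbolic_reflection.
Context {R : realType} {n : nat}.
Implicit Types (b x y : 'rV[R]_n).

(** The formula of [hmap] outside the subtype, with its denominator in the form given by [rhoE], so
    that the facts below become rational identities in inner products. *)
Definition hvec b x : 'rV[R]_n :=
  (rho b x)^-1 *: (dot (x - b) (x - b) *: b + (1 - dot b b) *: (b - x)).

Lemma dot_hvec b x : dot b b < 1 -> dot x x < 1 ->
  1 - dot (hvec b x) (hvec b x) = (1 - dot b b) * (1 - dot x x) / rho b x.
Proof.
move=> b1 x1; have := rho_gt0 b1 x1.
rewrite /hvec !dotE (dotC x b) => /lt0r_neq0.
(* [field] asks that an expanded denominator be nonzero; up to [ring] it is [rho b x]. *)
rewrite /rho => r0; field; move: r0; congr (_ != 0); ring.
Qed.

Lemma hvec_lt1 b x : dot b b < 1 -> dot x x < 1 ->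
  dot (hvec b x) (hvec b x) < 1.
Proof.
move=> b1 x1; rewrite -subr_gt0 dot_hvec// divr_gt0 ?rho_gt0//.
by rewrite mulr_gt0 ?subr_gt0.
Qed.

Lemma rho_hvec b x y : dot b b < 1 -> dot x x < 1 -> dot y y < 1 ->
  rho (hvec b x) (hvec b y) =
  rho x y * (1 - dot b b) ^+ 2 / (rho b x * rho b y).
Proof.
move=> b1 x1 y1; have := rho_gt0 b1 x1; have := rho_gt0 b1 y1.
rewrite /hvec /rho !dotE (dotC x b) (dotC y b).
move=> /lt0r_neq0 ry /lt0r_neq0 rx; field.
by apply/andP; split; [move: ry|move: rx]; congr (_ != 0); ring.
Qed.

(** This is the case of [rho_hvec] where one point is the origin, since h_b(0) = b. It provides the
    denominator for the second application of h_b in [hvec_inv]. *)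
Lemma rho_hvecK b x : dot b b < 1 -> dot x x < 1 ->
  rho b (hvec b x) = (1 - dot b b) ^+ 2 / rho b x.
Proof.
move=> b1 x1; have := rho_gt0 b1 x1; rewrite /hvec /rho !dotE (dotC x b).
move=> /lt0r_neq0 rx; field.
by move: rx; congr (_ != 0); ring.
Qed.

Lemma hvec_inv b x : dot b b < 1 -> dot x x < 1 -> hvec b (hvec b x) = x.
Proof.
move=> b1 x1; have r0 := lt0r_neq0 (rho_gt0 b1 x1).
have b0 : 1 - dot b b != 0 by rewrite gt_eqF// subr_gt0.
rewrite {1}/hvec rho_hvecK//.
apply/rowP => i; rewrite /hvec !mxE !dotE (dotC x b).
move: r0; rewrite /rho => r0; field.
by apply/andP; split => //; move: r0; congr (_ != 0); ring.
Qed.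

End hyperbolic_reflection.

(** * Tangent and chord inequalities for the logarithm *)

Lemma ln_le_subr1 (R : realType) (v : R) : 0 < v -> ln v <= v - 1.
Proof.
by move=> v0; have := @le_ln1Dx R (v - 1); rewrite subrKC; apply; lra.
Qed.

Lemma ln_lt_subr1 (R : realType) (v : R) : 0 < v -> v != 1 -> ln v < v - 1.
Proof.
move=> v0 v1; have /expR_gt1Dx : ln v != 0 by rewrite ln_eq0.
by rewrite lnK ?posrE// => ?; lra.
Qed.

(* [1 - r * q] is the convex combination of [1 + r] and [1 - r] with weights
   [(1 - q) / 2] and [(1 + q) / 2]. *)
Lemma ln_chord_lt (R : realType) (r q : R) : 0 < r < 1 -> -1 < q < 1 ->
  - q * ln ((1 + r) / (1 - r)) < ln ((1 - r * q) ^+ 2 / (1 - r ^+ 2)).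
Proof.
move=> /andP[r0 r1] /andP[q0 q1].
have M0 : 0 < 1 - r * q by nra.
have A0 : 0 < 1 + r by lra.
have B0 : 0 < 1 - r by lra.
have S0 : 0 < 1 - r ^+ 2 by nra.
have lA : ln ((1 + r) / (1 - r * q)) < (1 + r) / (1 - r * q) - 1.
  apply: ln_lt_subr1; first exact: divr_gt0.
  by rewrite gt_eqF// ltr_pdivlMr// mul1r; nra.
have lB : ln ((1 - r) / (1 - r * q)) < (1 - r) / (1 - r * q) - 1.
  apply: ln_lt_subr1; first exact: divr_gt0.
  by rewrite lt_eqF// ltr_pdivrMr// mul1r; nra.
rewrite !ln_div ?posrE ?exprn_gt0// in lA lB *.
rewrite lnXn// (_ : 1 - r ^+ 2 = (1 + r) * (1 - r)); last by ring.
rewrite lnM ?posrE//.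
(* The right-hand sides of [lA] and [lB] cancel with the weights 1 - q and 1 + q; both weights are
   positive, so strictness survives. *)
have : (1 - q) * ((1 + r) / (1 - r * q) - 1) +
       (1 + q) * ((1 - r) / (1 - r * q) - 1) = 0.
  by field; rewrite gt_eqF.
nra.
Qed.

(** * Pointwise identities and bounds for U(x, y) *)

Section potential.
Context {R : realType} {n : nat}.
Implicit Types (b x y w z : 'rV[R]_n).

(** For |y| = 1 this is log (|x - y|^2 / (1 - |x|^2)), the Busemann function of hyperbolic space at
    the boundary point y. *)
Definition potential x y : R := ln (rho x y / (1 - dot x x)).

(** The factor rho(b,x) cancels between [rho_hvec] and [dot_hvec]; what remains besides the argument
    of U(x,y) is (1 - |b|^2) / rho(b,y), whose logarithm is - U(b,y). *)
Lemma potential_hvec b x y : dot b b < 1 -> dot x x < 1 -> dot y y < 1 ->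
  potential (hvec b x) (hvec b y) = potential x y - potential b y.
Proof.
move=> b1 x1 y1; rewrite /potential rho_hvec// dot_hvec//.
have b0 : 0 < 1 - dot b b by rewrite subr_gt0.
have x0 : 0 < 1 - dot x x by rewrite subr_gt0.
have rbx := rho_gt0 b1 x1; have rby := rho_gt0 b1 y1.
have rxy := rho_gt0 x1 y1.
rewrite -ln_div ?posrE ?divr_gt0//; congr ln; field.
by rewrite !gt_eqF.
Qed.

Lemma potential_gt w z : w != 0 -> dot w w < 1 -> dot z z < 1 ->
  - (dot w z / enorm w) * ln ((1 + enorm w) / (1 - enorm w)) < potential w z.
Proof.
move=> w0 w1 z1.
have r1 : enorm w < 1 by rewrite enorm_lt1.
have r0 : 0 < enorm w.
  by rewrite lt0r enorm_ge0 andbT -sqrf_eq0 enormE dot_eq0.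
have z1' : enorm z < 1 by rewrite enorm_lt1.
set q := dot w z / enorm w.
have wzE : dot w z = enorm w * q by rewrite /q mulrC divfK// gt_eqF.
have := cauchy_schwarz_norm w z.
rewrite wzE normrM gtr0_norm// ler_pM2l// => qz.
have q1 : -1 < q < 1 by rewrite -ltr_norml (le_lt_trans qz).
apply: lt_le_trans (ln_chord_lt _ q1) _; first by rewrite r0.
have S0 : 0 < 1 - enorm w ^+ 2 by rewrite enormE subr_gt0.
have rwz := rho_gt0 w1 z1.
have M0 : 0 < 1 - enorm w * q.
  by rewrite subr_gt0 (le_lt_trans (ler_norm _))// normrM gtr0_norm//
    mulr_ilt1 ?enorm_ge0// (le_lt_trans qz).
rewrite /potential -enormE ler_ln ?posrE ?divr_gt0 ?exprn_gt0//.
rewrite ler_pM2r ?invr_gt0// /rho -!enormE wzE.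
(* With r = |w|, this turns rho(w,z) = 1 - 2rq + r^2 |z|^2 into a quantity at least (1 - rq)^2. *)
have : q ^+ 2 <= enorm z ^+ 2.
  by rewrite -real_normK ?num_real// ler_pXn2r ?nnegrE ?enorm_ge0.
have : 0 <= enorm w ^+ 2 by rewrite sqr_ge0.
nra.
Qed.

(** After log v <= v - 1, the term |w|^2 |z|^2 of the numerator is bounded by |w|^2, which leaves an
    expression affine in z. *)
Lemma potential_le w z : dot w w < 1 -> dot z z < 1 ->
  potential w z <= (dot w w - dot w z) *+ 2 / (1 - dot w w).
Proof.
move=> w1 z1; have w0 : 0 < 1 - dot w w by rewrite subr_gt0.
apply: le_trans (ln_le_subr1 _) _; first by rewrite divr_gt0// rho_gt0.
rewrite lerBlDr -[X in _ <= _ + X](mulfV (lt0r_neq0 w0)) -mulrDl.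
rewrite ler_pM2r ?invr_gt0// /rho.
have := dot_ge0 w; nra.
Qed.

(** Both sides come from [rho_ge] and [rho_le] with |y| bounded by 1. Uniformity in y makes U(x,.)
    integrable over sets of finite measure. *)
Lemma potential_bound x y : dot x x < 1 -> dot y y < 1 ->
  `|potential x y| <= ln ((1 + enorm x) / (1 - enorm x)).
Proof.
move=> x1 y1; have r1 : enorm x < 1 by rewrite enorm_lt1.
have s1 : enorm y < 1 by rewrite enorm_lt1.
have r0 := enorm_ge0 x; have s0 := enorm_ge0 y.
have S0 : 0 < 1 - dot x x by rewrite subr_gt0.
have rxy := rho_gt0 x1 y1.
have A0 : 0 < 1 + enorm x by lra.
have B0 : 0 < 1 - enorm x by lra.
have xE : 1 - dot x x = (1 + enorm x) * (1 - enorm x).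
  by rewrite -enormE; ring.
rewrite ler_norml -lnV ?posrE ?divr_gt0//.
rewrite /potential !ler_ln ?posrE ?invr_gt0 ?divr_gt0//; apply/andP; split.
- rewrite ler_pdivlMr// xE invf_div mulrA divfK ?gt_eqF//.
  apply: le_trans _ (rho_ge x y); rewrite -expr2 ler_pXn2r ?nnegrE//; nra.
- rewrite ler_pdivrMr// xE [X in _ <= _ * X]mulrC mulrA divfK ?gt_eqF//.
  apply: le_trans (rho_le x y) _; rewrite -expr2 ler_pXn2r ?nnegrE//; nra.
Qed.

(** Here rho(x,y) >= (1 - s)^2 and 1 - |x|^2 <= 2 (1 - |x|). The bound tends to infinity as |x|
    tends to 1, uniformly in |y| <= s. *)
Lemma potential_ge x y (s : R) : dot x x < 1 -> enorm y <= s -> s < 1 ->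
  ln (1 - s) *+ 2 - ln 2 - ln (1 - enorm x) <= potential x y.
Proof.
move=> x1 ys s1; have r1 : enorm x < 1 by rewrite enorm_lt1.
have y1 : dot y y < 1 by rewrite -enorm_lt1 (le_lt_trans ys).
have r0 := enorm_ge0 x; have s0 := enorm_ge0 y.
have S0 : 0 < 1 - dot x x by rewrite subr_gt0.
have rxy := rho_gt0 x1 y1.
have s'0 : 0 < 1 - s by lra.
have B0 : 0 < 1 - enorm x by lra.
rewrite -lnXn// -!ln_div ?posrE ?divr_gt0 ?exprn_gt0//.
rewrite ler_ln ?posrE ?divr_gt0 ?exprn_gt0// -mulrA -invfM.
apply: ler_pM; rewrite ?invr_ge0 ?sqr_ge0//; first by nra.
  apply: le_trans _ (rho_ge x y).
  by rewrite ler_pXn2r ?nnegrE//; nra.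
by rewrite lef_pV2 ?posrE ?mulr_gt0// -enormE; nra.
Qed.

(** Again log v <= v - 1, with v the ratio of the two arguments of the logarithm. The numerator of v
    - 1 is at most (4 + 4 * 2) |x - b|, whence 12, and its denominator is at least (1 - r)^2 (1 -
    r^2). *)
Lemma potential_lipschitz (r : R) b x y : r < 1 ->
  enorm b <= r -> enorm x <= r -> dot y y < 1 ->
  potential x y - potential b y <=
  12 / ((1 - r) ^+ 2 * (1 - r ^+ 2)) * enorm (x - b).
Proof.
move=> r1 br xr y1.
have s1 : enorm y < 1 by rewrite enorm_lt1.
have b0 := enorm_ge0 b; have x0 := enorm_ge0 x; have s0 := enorm_ge0 y.
have x1 : dot x x < 1 by rewrite -enorm_lt1 (le_lt_trans xr).
have b1 : dot b b < 1 by rewrite -enorm_lt1 (le_lt_trans br).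
have Sx : 0 < 1 - dot x x by rewrite subr_gt0.
have Sb : 0 < 1 - dot b b by rewrite subr_gt0.
have rby := rho_gt0 b1 y1; have rxy := rho_gt0 x1 y1.
have e0 := enorm_ge0 (x - b).
rewrite -ln_div ?posrE ?divr_gt0//.
apply: le_trans (ln_le_subr1 _) _; first by rewrite !divr_gt0.
rewrite (_ : _ - 1 = ((rho x y - rho b y) * (1 - dot b b) +
    rho b y * (dot x x - dot b b)) / (rho b y * (1 - dot x x))); last first.
  by field; rewrite !gt_eqF.
have D0 : 0 < (1 - r) ^+ 2 * (1 - r ^+ 2)
  by rewrite mulr_gt0 ?exprn_gt0 ?subr_gt0//; nra.
have hD : (1 - r) ^+ 2 * (1 - r ^+ 2) <= rho b y * (1 - dot x x).
  apply: ler_pM; [exact: sqr_ge0|nra| |by rewrite -enormE; nra].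
  by apply: le_trans _ (rho_ge b y); rewrite ler_pXn2r ?nnegrE//; nra.
have hxy : `|dot (x - b) y| <= enorm (x - b).
  by apply: le_trans (cauchy_schwarz_norm _ _) _; rewrite ler_piMr// ltW.
have hxx : `|dot (x - b) x| <= enorm (x - b).
  apply: le_trans (cauchy_schwarz_norm _ _) _; rewrite ler_piMr//; lra.
have hxb : `|dot (x - b) b| <= enorm (x - b).
  apply: le_trans (cauchy_schwarz_norm _ _) _; rewrite ler_piMr//; lra.
have xbE : dot x x - dot b b = dot (x - b) x + dot (x - b) b.
  by rewrite !dotE (dotC b x); ring.
have rE : rho x y - rho b y =
    - dot (x - b) y *+ 2 + (dot (x - b) x + dot (x - b) b) * dot y y.
  by rewrite -xbE /rho !dotE; ring.
have yy := dot_ge0 y; have bb := dot_ge0 b.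
have rb4 : rho b y <= 4.
  have : enorm b * enorm y <= 1 by rewrite mulr_ile1//; lra.
  have : 0 <= enorm b * enorm y by rewrite mulr_ge0.
  by move=> ? ?; apply: le_trans (rho_le b y) _; nra.
move: hxy hxx hxb; rewrite !ler_norml => /andP[y2 y3] /andP[x2 x3] /andP[b2 b3].
have h1 : rho x y - rho b y <= enorm (x - b) *+ 4.
  have : (dot (x - b) x + dot (x - b) b) * dot y y <= enorm (x - b) *+ 2 * 1.
    apply: (le_trans (y := enorm (x - b) *+ 2 * dot y y)).
      by rewrite ler_wpM2r// mulr2n lerD.
    by rewrite ler_wpM2l ?mulrn_wge0// ltW.
  by rewrite rE; lra.
have h2 : (rho x y - rho b y) * (1 - dot b b) <= enorm (x - b) *+ 4.
  have [|] := leP 0 (rho x y - rho b y); nra.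
have h3 : rho b y * (dot x x - dot b b) <= enorm (x - b) *+ 8.
  by rewrite xbE; nra.
have h4 : (rho x y - rho b y) * (1 - dot b b) +
    rho b y * (dot x x - dot b b) <= 12 * enorm (x - b) by lra.
rewrite ler_pdivrMr ?mulr_gt0//; apply: (le_trans h4).
(* The right-hand side is the left one times a quotient that is at least 1 by [hD]. *)
rewrite [leRHS](_ : _ = 12 * enorm (x - b) * (rho b y * (1 - dot x x) /
  ((1 - r) ^+ 2 * (1 - r ^+ 2)))); last by set u := ((1 - r) ^+ 2 * _)^-1; ring.
rewrite ler_peMr ?mulr_ge0//.
by rewrite ler_pdivlMr// mul1r.
Qed.

End potential.

(** * Translation of the kernel and of [hmap]; topology of the Euclidean norm *)

Lemma log_kernelE (R : realType) n (x y : unit_ball R n) :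
  log_kernel x y = ln (1 - enorm (\val y) ^+ 2) - potential (\val x) (\val y).
Proof.
rewrite /log_kernel [_ * (1 - enorm (val x) ^+ 2)]mulrC rhoE /potential !enormE.
have x1 := valP x; have y1 := valP y; rewrite /= !enorm_lt1 in x1 y1.
have Sx : 0 < 1 - dot (val x) (val x) by rewrite subr_gt0.
have Sy : 0 < 1 - dot (val y) (val y) by rewrite subr_gt0.
have r0 := rho_gt0 x1 y1.
rewrite -ln_div ?posrE ?divr_gt0//; congr ln; field.
by rewrite !gt_eqF.
Qed.

Lemma hmapE (R : realType) n (b x : unit_ball R n) :
  hmap b x = hvec (\val b) (\val x).
Proof.
rewrite /hmap /hvec /= -rhoE !enormE -(opprB (\val b)) dotNl dotNr opprK.
by [].
Qed.

Lemma hvec0 (R : realType) n (b : 'rV[R]_n) : hvec b 0 = b.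
Proof.
rewrite /hvec /rho subr0 sub0r dotNl dotNr opprK dotC !dot0l.
by rewrite mul0rn mulr0 subr0 addr0 invr1 scale1r -scalerDl subrKC scale1r.
Qed.

Lemma enorm_continuous (R : realType) n : continuous (@enorm R n).
Proof.
move=> x; apply: (@continuous_comp _ _ _
  (fun x : 'rV[R]_n => \sum_(i < n) x 0 i ^+ 2)).
  apply: continuous_big; first exact: add_continuous.
  move=> i _ y; apply: (@continuous_comp _ _ _
    (fun x : 'rV[R]_n => x 0 i) (fun z : R => z ^+ 2)).
    exact: coord_continuous.
  exact: exprn_continuous.
exact: sqrt_continuous.
Qed.

(** Boundedness refers to the sup norm, and each coordinate is at most the Euclidean norm in
    absolute value. *)
Lemma compact_enorm_le (R : realType) n (r : R) :
  compact [set x : 'rV[R]_n | enorm x <= r].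
Proof.
apply: bounded_closed_compact; last first.
  apply: (@preimage_closed _ _ (@enorm R n) [set y : R | y <= r]).
    by move=> x _; exact: enorm_continuous.
  exact: closed_le.
exists (Num.max r 0); split; first exact: num_real.
move=> M rM x /= xr; rewrite [leLHS]/Num.Def.normr /= mx_normrE.
apply: bigmax_le.
  by apply: ltW; apply: le_lt_trans rM; rewrite le_max lexx orbT.
move=> [i j] _ /=; apply: ltW; apply: le_lt_trans rM.
rewrite le_max (le_trans _ xr)// -(@ler_pXn2r _ 2) ?nnegrE ?enorm_ge0//.
rewrite real_normK ?num_real// enormE /dot (bigD1 j)//= -expr2 ord1 lerDl.
by apply: sumr_ge0 => k _; rewrite -expr2 sqr_ge0.
Qed.

(** * Integrals over a set of finite measure *)

Section bounded_integrand.
Context d (T : measurableType d) (R : realType).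
Variables (nu : {measure set T -> \bar R}) (D : set T).
Hypotheses (mD : measurable D) (D_fin : (nu D < +oo)%E).

Lemma bounded_integrable (f : T -> R) (M : R) : measurable_fun D f ->
  (forall t, D t -> `|f t| <= M) -> nu.-integrable D (EFin \o f).
Proof.
move=> mf fM; apply: measurable_bounded_integrable => //.
exists M; split; first exact: num_real.
by move=> y My t Dt /=; apply: le_trans (fM _ Dt) (ltW My).
Qed.

(** If the integral were zero, f would vanish almost everywhere on D; as f is positive on D, this
    would make D null. *)
Lemma Rintegral_gt0 (f : T -> R) : (0 < nu D)%E ->
  nu.-integrable D (EFin \o f) -> (forall t, D t -> 0 < f t) ->
  0 < \int[nu]_(t in D) f t.
Proof.
move=> D_gt0 intf f0.
rewrite lt0r Rintegral_ge0 ?andbT; last by move=> t /f0/ltW.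
apply/eqP => If0.
have : (\int[nu]_(t in D) `|(f t)%:E|)%E = 0%E.
  under eq_integral => t /set_mem Dt do rewrite gee0_abs ?lee_fin ?ltW ?f0//.
  by rewrite -[LHS]fineK ?integrable_fin_num//; congr EFin.
move/ae_eq_integral_abs => /(_ mD); case/integrableP: (intf) => mf _ /(_ mf).
move=> [N [mN N0 DN]].
have : nu D = 0%E.
  apply: (subset_measure0 mD mN) => // t Dt; apply: DN => /= /(_ Dt) [ft0].
  by have := f0 _ Dt; rewrite ft0 ltxx.
by move=> D0; rewrite D0 ltxx in D_gt0.
Qed.

End bounded_integrand.

(** * Zeros of the vector integral and minima of the energy, for a measurable map Y into the ball *)

Section barycenter.
Context d (T : measurableType d) (R : realType) (n : nat).
Variables (nu : {measure set T -> \bar R}) (D : set T) (Y : T -> 'rV[R]_n).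
Hypotheses (mD : measurable D) (D_gt0 : (0 < nu D)%E) (D_fin : (nu D < +oo)%E).
Hypotheses (mY : forall i, measurable_fun setT (fun t => Y t 0 i))
  (Y_lt1 : forall t, dot (Y t) (Y t) < 1).
Implicit Types (b x w : 'rV[R]_n).

Let m : R := fine (nu D).

Let m_gt0 : 0 < m.
Proof. by apply: fine_gt0; rewrite D_gt0. Qed.

Lemma measurable_dot x : measurable_fun setT (fun t => dot x (Y t)).
Proof. by apply: measurable_sum => i; exact: measurable_funM. Qed.

Lemma measurable_dotYY : measurable_fun setT (fun t => dot (Y t) (Y t)).
Proof. by apply: measurable_sum => i; exact: measurable_funM. Qed.

Lemma measurable_rho x : measurable_fun setT (fun t => rho x (Y t)).
Proof.
apply: measurable_funD.
  apply: measurable_funB => //.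
  under eq_fun do rewrite mulr2n.
  by apply: measurable_funD; exact: measurable_dot.
by apply: measurable_funM => //; exact: measurable_dotYY.
Qed.

Lemma measurable_potential x : measurable_fun setT (fun t => potential x (Y t)).
Proof.
apply: (measurableT_comp (@measurable_ln R)).
by apply: measurable_funM => //; exact: measurable_rho.
Qed.

Lemma measurable_hvec b i : dot b b < 1 ->
  measurable_fun setT (fun t => hvec b (Y t) 0 i).
Proof.
move=> b1.
(* The inverse is written as the power -1, a measurable function that agrees with it because [rho]
   is positive. *)
rewrite (_ : (fun _ => _) = (fun t => (rho b (Y t)) `^ (-1) *
  ((dot (Y t) (Y t) - dot b (Y t) *+ 2 + dot b b) * b 0 i +
   (1 - dot b b) * (b 0 i - Y t 0 i)))); last first.
  apply/funext => t; rewrite powR_inv1 ?ltW ?rho_gt0//.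
  rewrite /hvec !mxE !dotE (dotC (Y t) b).
  by congr (_ * (_ * _ + _)); ring.
apply: measurable_funM.
  by apply: (measurableT_comp (@measurable_powR R (-1))); exact: measurable_rho.
apply: measurable_funD; apply: measurable_funM => //; last first.
  exact: measurable_funB.
apply: measurable_funD => //.
apply: measurable_funB; first exact: measurable_dotYY.
under eq_fun do rewrite mulr2n.
by apply: measurable_funD; exact: measurable_dot.
Qed.

Lemma integrable_potential x : dot x x < 1 ->
  nu.-integrable D (EFin \o (fun t => potential x (Y t))).
Proof.
move=> x1; apply: (bounded_integrable mD D_fin) => [|t _].
  by apply: measurable_funTS; exact: measurable_potential.
exact: potential_bound.
Qed.

Lemma integrable_hvec b i : dot b b < 1 ->
  nu.-integrable D (EFin \o (fun t => hvec b (Y t) 0 i)).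
Proof.
move=> b1; apply: (@bounded_integrable _ _ _ _ _ mD D_fin _ 1) => [|t _].
  by apply: measurable_funTS; exact: measurable_hvec.
rewrite -(@ler_pXn2r _ 2) ?nnegrE// expr1n real_normK ?num_real//.
apply: le_trans (ltW (hvec_lt1 b1 (Y_lt1 t))).
rewrite /dot (bigD1 i)//= -expr2 lerDl.
by apply: sumr_ge0 => k _; rewrite -expr2 sqr_ge0.
Qed.

Definition vec_integral b : 'rV[R]_n :=
  \row_i (\int[nu]_(t in D) hvec b (Y t) 0 i).

Lemma integrable_dot_hvec b w : dot b b < 1 ->
  nu.-integrable D (EFin \o (fun t => dot w (hvec b (Y t)))).
Proof.
move=> b1.
rewrite (_ : EFin \o _ =
    fun t => (\sum_(i <- index_enum 'I_n)
      (w 0 i)%:E * (hvec b (Y t) 0 i)%:E)%E).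
  apply: integrable_sum => // i _; apply: integrableZl => //.
  exact: integrable_hvec.
by apply/funext => t /=; rewrite /dot -sumEFin.
Qed.

Lemma Rintegral_dot_hvec b w : dot b b < 1 ->
  \int[nu]_(t in D) dot w (hvec b (Y t)) = dot w (vec_integral b).
Proof.
move=> b1; rewrite /Rintegral.
rewrite (eq_integral (fun t =>
    (\sum_(i <- index_enum 'I_n) (w 0 i * hvec b (Y t) 0 i)%:E)%E)); last first.
  by move=> t _; rewrite /dot -sumEFin.
rewrite integral_sum//; last first.
  move=> i; under eq_fun do rewrite EFinM; apply: integrableZl => //.
  exact: integrable_hvec.
rewrite /dot (eq_bigr (fun i => (w 0 i * vec_integral b 0 i)%:E)) ?sumEFin//.
move=> i _; under eq_integral do rewrite EFinM.
rewrite integralZl//; last exact: integrable_hvec.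
rewrite mxE EFinM fineK// integrable_fin_num//; exact: integrable_hvec.
Qed.

Definition energy x : R := \int[nu]_(t in D) potential x (Y t).

Lemma energyB b x : dot b b < 1 -> dot x x < 1 ->
  energy x - energy b = \int[nu]_(t in D) potential (hvec b x) (hvec b (Y t)).
Proof.
move=> b1 x1; rewrite -RintegralB//; try exact: integrable_potential.
by apply: eq_Rintegral => t _; rewrite potential_hvec.
Qed.

Lemma integrable_potential_hvec b x : dot b b < 1 -> dot x x < 1 ->
  nu.-integrable D (EFin \o (fun t => potential (hvec b x) (hvec b (Y t)))).
Proof.
move=> b1 x1.
rewrite (_ : EFin \o _ = ((EFin \o (fun t => potential x (Y t))) \-
    (EFin \o (fun t => potential b (Y t))))%E).
  by apply: integrableB => //; exact: integrable_potential.
by apply/funext => t /=; rewrite potential_hvec.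
Qed.

Lemma energy_lt b x : dot b b < 1 -> dot x x < 1 -> vec_integral b = 0 ->
  x != b -> energy b < energy x.
Proof.
move=> b1 x1 b0 xb; rewrite -subr_gt0 energyB//.
set w := hvec b x.
have w0 : w != 0.
  by apply: contra_neq xb => w0; rewrite -(hvec_inv b1 x1) -/w w0 hvec0.
have w1 : dot w w < 1 by exact: hvec_lt1.
(* With this constant the lower bound of [potential_gt] is the linear form - (c w).z. *)
set c := ln ((1 + enorm w) / (1 - enorm w)) / enorm w.
have ig := integrable_dot_hvec (c *: w) b1.
have ip := integrable_potential_hvec b1 x1.
(* The added linear term integrates to (c w).[vec_integral b] = 0 and makes the integrand positive
   at every point of D. *)
have -> : \int[nu]_(t in D) potential w (hvec b (Y t)) =
    \int[nu]_(t in D)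
      (potential w (hvec b (Y t)) + dot (c *: w) (hvec b (Y t))).
  by rewrite RintegralD// Rintegral_dot_hvec// b0 dotC dot0l addr0.
apply: Rintegral_gt0 => //; first exact: (integrableD mD ip ig).
move=> t Dt; rewrite dotZl /c -ltrBlDr sub0r.
apply: le_lt_trans (potential_gt w0 w1 (hvec_lt1 b1 (Y_lt1 t))).
by rewrite le_eqVlt; apply/orP; left; apply/eqP; ring.
Qed.

Lemma vec_integral_eq0 b : dot b b < 1 ->
  (forall x, dot x x < 1 -> energy b <= energy x) -> vec_integral b = 0.
Proof.
move=> b1 bmin; set v := vec_integral b.
apply/eqP; rewrite -dot_eq0 eq_le dot_ge0 andbT leNgt; apply/negP => v0.
(* Comparing b with h_b(w): 0 <= E(h_b(w)) - E(b), which is the integral of U(w, h_b(y)), hence at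
   most 2 (m |w|^2 - w.v) / (1 - |w|^2). *)
have hw w : dot w w < 1 -> dot w v <= m * dot w w.
  move=> w1; have x1 := hvec_lt1 b1 w1.
  have := bmin _ x1; rewrite -subr_ge0 energyB// hvec_inv// => ge0.
  have w0 : 0 < 1 - dot w w by rewrite subr_gt0.
  have ip := integrable_potential_hvec b1 x1; rewrite hvec_inv// in ip.
  have iw := integrable_dot_hvec w b1.
  have ic : nu.-integrable D (EFin \o fun=> dot w w).
    exact: (@bounded_integrable _ _ _ _ _ mD D_fin _ (`|dot w w|)).
  have ib := integrableB mD ic iw.
  have : 0 <= \int[nu]_(t in D)
      (2 / (1 - dot w w) * (dot w w - dot w (hvec b (Y t)))).
    apply: (le_trans ge0); apply: le_Rintegral => //.
      exact: (integrableZl mD (2 / (1 - dot w w)) ib).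
    move=> t Dt; apply: le_trans (potential_le w1 (hvec_lt1 b1 (Y_lt1 t))) _.
    by rewrite le_eqVlt; apply/orP; left; apply/eqP; ring.
  rewrite RintegralZl// pmulr_rge0 ?divr_gt0// RintegralB// Rintegral_cst//.
  by rewrite Rintegral_dot_hvec// subr_ge0 mulrC.
(* Both e < 1 and e |v|^2 < 1 hold, so w = e v lies in the ball; and e m < 1 contradicts e |v|^2 <=
   m e^2 |v|^2. *)
pose e := (1 + m + dot v v)^-1.
have e0 : 0 < e by rewrite invr_gt0; have := m_gt0; lra.
have eE : e * (1 + m + dot v v) = 1 by rewrite mulVf// gt_eqF// -invr_gt0.
have := hw (e *: v); rewrite !dotE => /(_ _)/wrap[|].
  have := m_gt0; nra.
have := m_gt0 => m0; rewrite !mulrA -subr_ge0 -mulrBl pmulr_lge0//.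
by rewrite [m * e]mulrC -mulrA -[e in X in _ - X]mulr1; nra.
Qed.

End barycenter.

(** * Existence of a minimum of the energy, and its relation to G *)

Section minimum.
Context d (T : measurableType d) (R : realType) (n : nat).
Variables (nu : {measure set T -> \bar R}) (D : set T) (Y : T -> 'rV[R]_n).
Hypotheses (mD : measurable D) (D_gt0 : (0 < nu D)%E) (D_fin : (nu D < +oo)%E).
Hypotheses (mY : forall i, measurable_fun setT (fun t => Y t 0 i))
  (Y_lt1 : forall t, dot (Y t) (Y t) < 1).
Implicit Types (b x w : 'rV[R]_n).

Let m : R := fine (nu D).

Let m_gt0 : 0 < m.
Proof. by apply: fine_gt0; rewrite D_gt0. Qed.

Local Notation E := (energy nu D Y).

Lemma energy_lipschitz (r : R) b x : r < 1 -> enorm b <= r -> enorm x <= r ->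
  E x - E b <=
  m * (12 / ((1 - r) ^+ 2 * (1 - r ^+ 2)) * enorm (x - b)).
Proof.
move=> r1 br xr.
have b1 : dot b b < 1 by rewrite -enorm_lt1 (le_lt_trans br).
have x1 : dot x x < 1 by rewrite -enorm_lt1 (le_lt_trans xr).
have ix := integrable_potential mD D_fin mY Y_lt1 x1.
have ib := integrable_potential mD D_fin mY Y_lt1 b1.
rewrite -RintegralB// mulrC -Rintegral_cst//.
apply: le_Rintegral => //; first exact: (integrableB mD ix ib).
  exact: (@bounded_integrable _ _ _ _ _ mD D_fin _
    `|12 / ((1 - r) ^+ 2 * (1 - r ^+ 2)) * enorm (x - b)|).
by move=> t _; exact: potential_lipschitz.
Qed.

Lemma energy_continuous (r : R) : r < 1 ->
  {within [set x | enorm x <= r], continuous E}.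
Proof.
move=> r1; apply/subspace_continuousP => b br.
set c := m * (12 / ((1 - r) ^+ 2 * (1 - r ^+ 2))).
have c0 : 0 <= c.
  have r0 : 0 <= r by apply: le_trans (enorm_ge0 b) br.
  rewrite mulr_ge0 ?ltW// divr_gt0// mulr_gt0 ?exprn_gt0 ?subr_gt0//.
  by rewrite expr_lt1.
apply/cvgrPdist_lt => e e0; rewrite near_withinE.
have : enorm (x - b) @[x --> b] --> (0 : R).
  have -> : (0 : R) = enorm (b - b) by rewrite subrr enorm0.
  apply: (@continuous_comp _ _ _ (fun x => x - b) (@enorm R n)).
    by apply: continuousB => //; exact: cst_continuous.
  exact: enorm_continuous.
move=> /cvgrPdist_lt/(_ (e / (c + 1))).
rewrite divr_gt0 ?ltr_wpDl// => /(_ isT).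
apply: filterS => x; rewrite sub0r normrN ger0_norm ?enorm_ge0// => xb xr.
have bx : enorm (b - x) = enorm (x - b).
  rewrite /enorm; congr Num.sqrt; apply: eq_bigr => i _.
  by rewrite !mxE -sqrrN opprB.
have := energy_lipschitz r1 br xr; have := energy_lipschitz r1 xr br.
rewrite bx mulrA -/c.
have : c * enorm (x - b) < e.
  move: xb; rewrite ltr_pdivlMr ?ltr_wpDl//; apply: le_lt_trans.
  by rewrite mulrC ler_wpM2l ?enorm_ge0// lerDl.
move=> h1 h2 h3; rewrite /from_subspace ltr_norml; apply/andP; split; lra.
Qed.

(** The balls of radius 1 - 1/(k+1) exhaust D, so by continuity from below their masses tend to m,
    which exceeds m/2 because m > 0. *)
Lemma half_mass_ball : exists2 s : R, s < 1 &
  (measurable (D `&` [set t | enorm (Y t) <= s])) /\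
  m < fine (nu (D `&` [set t | enorm (Y t) <= s])) *+ 2.
Proof.
pose s k : R := 1 - k.+1%:R^-1.
pose F k := D `&` [set t | enorm (Y t) <= s k].
have mF k : measurable (F k).
  (* Nonnegativity allows |y| <= s k to be squared, which reduces measurability to that of
     [dot (Y t) (Y t)]. *)
  have sk0 : 0 <= s k by rewrite subr_ge0 invf_le1 ?ltr0n// ler1n.
  apply: measurableI => //; rewrite -[X in measurable X]setTI.
  have := measurable_dotYY mY measurableT (measurable_itv `]-oo, s k ^+ 2]).
  congr measurable; congr (_ `&` _); apply/seteqP.
  by split => t /=; rewrite in_itv/= -enormE ler_pXn2r ?nnegrE ?enorm_ge0.
have UF : \bigcup_k F k = D.
  apply/seteqP; split => [t [k _ []]//|t Dt].
  have /ltr_add_invr[k hk] : enorm (Y t) < 1 by rewrite enorm_lt1.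
  by exists k => //; split => //=; rewrite /s lerBrDr ltW.
have ndF : nondecreasing_seq F.
  move=> i j ij; apply/subsetPset => t [Dt /= ti]; split => //=.
  by apply: (le_trans ti); rewrite lerB// lef_pV2 ?posrE ?ltr0n// ler_nat ltnS.
have := @nondecreasing_cvg_mu _ _ _ nu F mF _ ndF; rewrite UF => /(_ mD) cvF.
have [k hk] : exists k, ((m / 2)%:E < nu (F k))%E.
  apply/not_existsP => /= hF.
  have : (nu D <= (m / 2)%:E)%E.
    rewrite -(cvg_lim _ cvF)//; apply: lime_le.
      by apply/cvg_ex; exists (nu D).
    by apply: nearW => k; rewrite leNgt; apply/negP/hF.
  rewrite -[nu D]fineK ?ge0_fin_numE// lee_fin -/m; have := m_gt0; lra.
exists (s k); first by rewrite /s gtrDl oppr_lt0 invr_gt0 ltr0n.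
split; first exact: mF.
have Fk_fin : nu (F k) \is a fin_num.
  rewrite ge0_fin_numE//; apply: le_lt_trans D_fin.
  by rewrite le_measure ?inE//; exact: subIsetl.
by move: hk; rewrite -[nu (F k)]fineK// lte_fin -/(F k); lra.
Qed.

Lemma exists_energy_min : exists2 b, dot b b < 1 &
  forall x, dot x x < 1 -> E b <= E x.
Proof.
have [s s1 [mS mS2]] := half_mass_ball.
set S := D `&` _ in mS mS2.
have S_fin : (nu S < +oo)%E.
  by apply: le_lt_trans D_fin; rewrite le_measure ?inE//; exact: subIsetl.
have SC_fin : (nu (D `\` S) < +oo)%E.
  by apply: le_lt_trans D_fin; rewrite le_measure ?inE//; exact: measurableD.
set ms := fine (nu S) in mS2.
(* [potential_ge] is integrated over S and [potential_bound] over the rest. The coefficient m - 2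
   [ms] is negative, so the bound tends to infinity at the sphere. *)
have lb x : dot x x < 1 ->
    (m - ms *+ 2) * ln (1 - enorm x) - m * ln 2 + ms * ln (1 - s) *+ 2 <= E x.
  move=> x1.
  have ix := integrable_potential mD D_fin mY Y_lt1 x1.
  have SD : D = S `|` (D `\` S) by rewrite setDUK//; exact: subIsetl.
  have mSC : measurable (D `\` S) by exact: measurableD.
  have dS : [disjoint S & D `\` S] by apply/disj_setPS => t [? []].
  have mE : m = ms + fine (nu (D `\` S)).
    rewrite /m {1}SD measureU ?fineD ?ge0_fin_numE//.
    by apply/disj_set2P.
  have r1 : enorm x < 1 by rewrite enorm_lt1.
  have x0 := enorm_ge0 x.
  have iS := integrable_potential mS S_fin mY Y_lt1 x1.
  have iSC := integrable_potential mSC SC_fin mY Y_lt1 x1.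
  have hS : (ln (1 - s) *+ 2 - ln 2 - ln (1 - enorm x)) * ms <=
      \int[nu]_(t in S) potential x (Y t).
    rewrite -Rintegral_cst//; apply: le_Rintegral => //.
      exact: (@bounded_integrable _ _ _ _ _ mS S_fin _
        `|ln (1 - s) *+ 2 - ln 2 - ln (1 - enorm x)|).
    by move=> t [_ ts]; exact: potential_ge.
  have hSC : (ln (1 - enorm x) - ln 2) * fine (nu (D `\` S)) <=
      \int[nu]_(t in D `\` S) potential x (Y t).
    rewrite -Rintegral_cst//; apply: le_Rintegral => //.
      exact: (@bounded_integrable _ _ _ _ _ mSC SC_fin _
        `|ln (1 - enorm x) - ln 2|).
    move=> t _; have := potential_bound x1 (Y_lt1 t).
    rewrite ler_norml => /andP[+ _]; apply: le_trans.
    have A0 : 0 < 1 + enorm x by lra.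
    have B0 : 0 < 1 - enorm x by lra.
    rewrite ln_div ?posrE// opprB lerB// ler_ln ?posrE//; lra.
  rewrite /energy SD Rintegral_setU -?SD//.
  rewrite mE; lra.
pose delta := ms *+ 2 - m.
have delta0 : 0 < delta by rewrite subr_gt0.
(* The bound [lb] is positive as soon as 1 - |x| < [eta]. Outside radius r the energy is thus at
   least 0 = E(0), and the maximum with 0 keeps the origin in the compact ball. *)
pose eta := expR ((ms * ln (1 - s) *+ 2 - m * ln 2) / delta).
pose r := Num.max 0 (1 - eta).
have r1 : r < 1 by rewrite gt_max ltr01 gtrDl oppr_lt0 expR_gt0.
have r0 : 0 <= r by rewrite le_max lexx.
have E0 : E 0 = 0.
  rewrite /energy /Rintegral (eq_integral (cst 0%E)) ?integral0// => t _.
  by rewrite /potential /rho !dot0l mul0rn mul0r subr0 addr0 divr1 ln1.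
have A0 : [set x : 'rV[R]_n | enorm x <= r] !=set0.
  by exists 0; rewrite /= enorm0.
have [b bA bmin] :=
  EVT_min_rV A0 (@compact_enorm_le R n r) (energy_continuous r1).
move: bA; rewrite inE /= => br.
exists b => [|x x1]; first by rewrite -enorm_lt1 (le_lt_trans br).
have [xr|rx] := leP (enorm x) r; first by apply: bmin; rewrite inE.
apply: (@le_trans _ _ 0); first by rewrite -E0 bmin// inE /= enorm0.
apply: le_trans (lb _ x1).
have x1' : enorm x < 1 by rewrite enorm_lt1.
have eta_gt : 1 - enorm x < eta.
  have : 1 - eta <= r by rewrite le_max lexx orbT.
  lra.
have : ln (1 - enorm x) < (ms * ln (1 - s) *+ 2 - m * ln 2) / delta.
  by rewrite -[X in _ < X]expRK ltr_ln ?posrE ?expR_gt0 ?subr_gt0.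
by rewrite ltr_pdivlMr// /delta; lra.
Qed.

(** For points of the ball this is 2 log cosh (d/2), with d the hyperbolic distance of curvature -1
    between x and [Y t]: the opposite of [log_kernel]. *)
Definition green x t : R := potential x (Y t) - ln (1 - dot (Y t) (Y t)).

(** By [rhoE], rho(x,y) exceeds (1 - |x|^2)(1 - |y|^2) by |x - y|^2. *)
Lemma green_ge0 x t : dot x x < 1 -> 0 <= green x t.
Proof.
move=> x1; rewrite subr_ge0 ler_ln ?posrE ?divr_gt0 ?subr_gt0 ?rho_gt0//.
rewrite ler_pdivlMr ?subr_gt0// -!enormE mulrC -rhoE lerDr.
by rewrite sqr_ge0.
Qed.

Lemma measurable_green x : measurable_fun setT (green x).
Proof.
apply: measurable_funB; first exact: measurable_potential.
apply: (measurableT_comp (@measurable_ln R)).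
by apply: measurable_funB => //; exact: measurable_dotYY.
Qed.

(** The possibly unbounded term log (1 - |y|^2) cancels in the difference of the integrands, so
    finiteness at x passes to every c. *)
Lemma integral_green_shift x c : dot x x < 1 -> dot c c < 1 ->
  (\int[nu]_(t in D) (green x t)%:E < +oo)%E ->
  (\int[nu]_(t in D) (green c t)%:E =
   \int[nu]_(t in D) (green x t)%:E + (E c - E x)%:E)%E.
Proof.
move=> x1 c1 Gx.
have ix : nu.-integrable D (EFin \o green x).
  apply/integrableP; split.
    by apply/measurable_EFinP; apply: measurable_funTS; exact: measurable_green.
  under eq_integral do rewrite gee0_abs ?lee_fin ?green_ge0//.
  exact: Gx.
have pc := integrable_potential mD D_fin mY Y_lt1 c1.
have px := integrable_potential mD D_fin mY Y_lt1 x1.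
have icx := integrableB mD pc px.
rewrite -RintegralB// /Rintegral fineK; last exact: integrable_fin_num.
rewrite -integralD//; apply: eq_integral => t _.
by rewrite -EFinD; congr EFin; rewrite /green; ring.
Qed.

End minimum.

(** * The inclusion of the ball, with the completed measure, as the map Y *)

Section ball.
Context (R : realType) (n : nat).
Variable mu : {measure set (borel_ball R n) -> \bar R}.
Implicit Types (x b : unit_ball R n).

Let Y (t : caratheodory_type (mu^*)%mu) : 'rV[R]_n := \val (t : unit_ball R n).

Lemma dot_val_lt1 x : dot (\val x) (\val x) < 1.
Proof. by rewrite -enorm_lt1; exact: valP x. Qed.

(** Open intervals suffice: their preimages are open in the initial topology, hence Borel, hence
    Caratheodory measurable. *)
Lemma measurable_coord i : measurable_fun setT (fun t => Y t 0 i).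
Proof.
apply: (measurability _ (RGenOpens.measurableE R)) => _ [_ [a [b ->] <-]].
rewrite setTI; apply: caratheodory_measurable_mu_ext.
apply: sub_sigma_algebra.
rewrite /= /open /=.
have : @open ('rV[R]_n) ((fun v => v 0 i) @^-1` `]a, b[%classic).
  apply: open_comp => [v _|]; [exact: coord_continuous|exact: interval_open].
by move=> oA; exists ((fun v : 'rV[R]_n => v 0 i) @^-1` `]a, b[%classic).
Qed.

Lemma vintegral_hmap D b :
  vintegral (completed mu) D (hmap b) =
  vec_integral (completed mu) D Y (\val b).
Proof.
by apply/rowP => i; rewrite !mxE; apply: eq_Rintegral => t _; rewrite hmapE.
Qed.

Lemma GfunE D x :
  Gfun mu D x = (\int[completed mu]_(t in D) (green Y (\val x) t)%:E)%E.
Proof.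
rewrite /Gfun; under eq_integral => t _.
  rewrite log_kernelE enormE -[_ - _]opprB EFinN -/(green Y (\val x) t). over.
(* The sign leaves the integral because [green] is nonnegative, even if the integral is infinite. *)
rewrite integral_ge0N ?oppeK// => t _; rewrite lee_fin.
by apply: green_ge0 => //; [move=> ?|]; exact: dot_val_lt1.
Qed.

End ball.

Theorem theorem4p1 (R : realType) (n : nat)
    (mu : {measure set (borel_ball R n) -> \bar R})
    (hmu : lusin_N mu)
    (D : set (unit_ball R n))
    (mD : mu_measurable mu D)
    (D_gt0 : (0 < completed mu D)%E)
    (D_fin : (completed mu D < +oo)%E) :
  (exists! b : unit_ball R n,
     vintegral (completed mu) D (hmap b) = 0) /\
  (forall b : unit_ball R n,
     vintegral (completed mu) D (hmap b) = 0 ->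
     minimizer (Gfun mu D) b /\
     ((exists x : unit_ball R n, (Gfun mu D x < +oo)%E) ->
      forall c : unit_ball R n, minimizer (Gfun mu D) c -> c = b)).
Proof.
pose Y (t : caratheodory_type (mu^*)%mu) : 'rV[R]_n := \val (t : unit_ball R n).
have mY : forall i, measurable_fun setT (fun t => Y t 0 i).
  exact: measurable_coord.
have Y1 t : dot (Y t) (Y t) < 1 by exact: dot_val_lt1.
pose U (x : unit_ball R n) := energy (completed mu) D Y (\val x).
have U_lt b x : vintegral (completed mu) D (hmap b) = 0 -> x != b -> U b < U x.
  rewrite vintegral_hmap => b0 xb.
  apply: energy_lt => //; exact: dot_val_lt1.
have U_le b x : vintegral (completed mu) D (hmap b) = 0 -> U b <= U x.
  by move=> b0; have [->//|/(U_lt _ _ b0)/ltW] := eqVneq x b.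
have shift x c : (Gfun mu D x < +oo)%E ->
    Gfun mu D c = (Gfun mu D x + (U c - U x)%:E)%E.
  rewrite !GfunE => Gx; apply: integral_green_shift => //; exact: dot_val_lt1.
split.
  have [b b1 bmin] := exists_energy_min mD D_gt0 D_fin mY Y1.
  have b1' : enorm b < 1 by rewrite enorm_lt1.
  exists (exist _ b b1'); split=> [|c c0].
    rewrite vintegral_hmap; exact: vec_integral_eq0.
  (* A second zero c would have energy below that of b, against the minimality of b. *)
  apply/eqP/negP => /negP bc.
  have := U_lt _ _ c0 bc; rewrite ltNge => /negP; apply.
  by apply: bmin; exact: dot_val_lt1.
move=> b b0; split=> [x|[x Gx] c cmin].
  (* Only finite values of G at x matter, and there G(b) - G(x) = U(b) - U(x). *)
  have [->|] := eqVneq (Gfun mu D x) +oo%E; first by rewrite leey.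
  rewrite -ltey => Gx; rewrite (shift x)// geeDl// lee_fin subr_le0.
  exact: U_le.
(* Finiteness is carried from x to b, so that U(b) < U(c) yields the strict inequality G(b) < G(c)
   for c <> b. *)
have Gb : (Gfun mu D b < +oo)%E.
  by rewrite (shift x)// lte_add_pinfty// ltry.
apply/eqP/negP => /negP cb; have := cmin b; apply/negP; rewrite -ltNge.
rewrite (shift b c)// lteDl ?lte_fin ?subr_gt0; last first.
  rewrite ge0_fin_numE// GfunE integral_ge0// => t _.
  by rewrite lee_fin green_ge0// dot_val_lt1.
exact: U_lt.
Qed.
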